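(* For all integers $n\geq0$ and $s\geq0$, the following identity holds (as polynomials in $c$ and $x$): $$\sum_{r=0}^{n}\sum_{k=r}^{n}\widetilde{S}(n,k,r)\,c^{n+rs}x^{k}=c^{n}\,T_{n}\big((c^{s}+1)x\big).$$ In particular $\sum_{k=0}^{n}\Big(\sum_{r=0}^{k}\widetilde{S}(n,k,r)\Big)x^{k}=T_{n}(2x)$, so that $\sum_{r=0}^{k}\widetilde{S}(n,k,r)=2^{k}S(n,k)$ for all $0\leq k\leq n$.
   Context: $S(n,k)$ is the classical Stirling number of the second kind and $T_n(x)=\sum_{k=0}^{n}S(n,k)x^k$ is the Touchard polynomial. A partition $\lambda$ is a finite weakly decreasing sequence of positive integers $a_1,\dots,a_L$ (the empty partition is allowed), with length $\ell(\lambda)=L$ and $|\lambda|=\sum_l a_l$; $\lambda\vdash N$ means $|\lambda|=N$. For $i\geq1$, $m_i=m_i(\lambda)$ is the number of indices $l$ with $a_l=i$. For $s\geq0$, $\lambda^{>s}$ is the partition obtained by deleting all parts $a_l\leq s$; $(a)_s=\prod_{\upsilon=0}^{s-1}(a-\upsilon)$; $(\mu)_s$ is the sequence obtained by replacing each part $a_l$ of a partition $\mu$ by $(a_l)_s$. $e_r$ of a finite sequence is the $r$th elementary symmetric function of its entries ($e_0=1$; $e_r=0$ if there are fewer than $r$ entries). The modified partial Bell polynomial is $$\widetilde{\mathcal{B}}_{n,k,r}^{(s)}(y_{1},y_2,\ldots)=\sum_{\substack{\lambda \vdash n+rs \\ \ell(\lambda)=k \\ \ell(\lambda^{>s}) \geq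 r}}\frac{n!\,e_{r}\big((\lambda^{>s})_{s}\big)}{\prod_{i\geq1}(i!)^{m_{i}}m_{i}!}\prod_{i\geq1}y_{i}^{m_{i}}.$$ It is homogeneous of degree $k$, and of weighted degree $n+rs$ when $y_i$ has weight $i$. The modified Stirling number of the second kind $\widetilde{S}(n,k,r)$ is the number such that substituting $y_i=c^i x$ for all $i$ turns $\widetilde{\mathcal{B}}_{n,k,r}^{(s)}$ into $c^{n+rs}\,\widetilde{S}(n,k,r)\,x^{k}$; equivalently it is the value of $\widetilde{\mathcal{B}}_{n,k,r}^{(s)}$ at $y_i=1$ for all $i$ (this turns out not to depend on $s$). *)

(* Defs.v *)
From mathcomp Require Import all_boot all_order all_algebra.
From mathcomp Require Export mpoly.
Set Implicit Arguments.
Unset Strict Implicit.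
Unset Printing Implicit Defensive.
Import GRing.Theory.
Local Open Scope ring_scope.

Definition stirling2 (n k : nat) : nat :=
  #|[set P : {set {set 'I_n}} | partition P [set: 'I_n] & #|P| == k]|.

Definition touchard (R : nzRingType) (n : nat) : {poly R} :=
  \sum_(k < n.+1) (stirling2 n k)%:R *: 'X^k.

Definition is_intpart (N : nat) (la : seq nat) : bool :=
  [&& sorted geq la, 0%N \notin la & sumn la == N].

Definition parts_gt (s : nat) (la : seq nat) : seq nat :=
  [seq a <- la | (s < a)%N].

Definition falling_parts (s : nat) (mu : seq nat) : seq nat :=
  [seq (a ^_ s)%N | a <- mu].

Definition elem_sym (r : nat) (l : seq nat) : rat :=
  (mesym (size l) rat r).@[fun i => (nth 0%N l i)%:R].

Section ModifiedBell.
Variables s n k r : nat.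

(* The parts of a partition of N are at most N, so m_i = 0 for i > N: products
   over all i >= 1 may be taken over 1 <= i <= N, and the only indeterminates
   that occur are y_1, ..., y_N.  The index i : 'I_N stands for i + 1, and
   'X_i : {mpoly rat[N]} for y_(i+1). *)
Definition bell_coef (N : nat) (la : seq nat) : rat :=
  (n`!)%:R * elem_sym r (falling_parts s (parts_gt s la))
  / (\prod_(i < N) (i.+1`! ^ count_mem i.+1 la * (count_mem i.+1 la)`!))%:R.

Definition bell_monomial (N : nat) (la : seq nat) : {mpoly rat[N]} :=
  \prod_(i < N) 'X_i ^+ count_mem i.+1 la.

(* A partition of N with k parts is a k-tuple of elements of {0, ..., N}
   satisfying is_intpart N. *)
Definition mod_bell : {mpoly rat[n + r * s]} :=
  let N := (n + r * s)%N in
  \sum_(t : k.-tuple 'I_N.+1 |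
          is_intpart N (map val t) && (r <= size (parts_gt s (map val t)))%N)
     bell_coef N (map val t) *: bell_monomial N (map val t).

(* The modified Stirling number S~(n,k,r), computed from the polynomial with
   parameter s; the parameter is kept explicit, since independence of s is a
   theorem. *)
Definition mod_stirling2 : rat := mod_bell.@[fun=> 1].

(* For a partition of N with all parts in {0, ..., N}: the multiplicities add
   up to the length, and weighted by the part sizes they add up to N. *)
Lemma sum_count (N : nat) (la : seq nat) :
  0%N \notin la -> all (fun a => a <= N)%N la ->
  (\sum_(i < N) count_mem i.+1 la = size la)%N /\
  (\sum_(i < N) i.+1 * count_mem i.+1 la = sumn la)%N.
Proof.
elim: la => [|a la IH] /=.
  by split; apply: big1 => i _ //; rewrite muln0.
rewrite inE negb_or => /andP[a0 n0] /andP[aN lN].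
have [IH1 IH2] := IH n0 lN.
have aP : (a.-1 < N)%N by case: a a0 aN.
have aE (i : 'I_N) : (a == i.+1) = (i == Ordinal aP).
  by case: a a0 aN aP => // a _ _ aP; rewrite eqSS -val_eqE eq_sym.
split.
  rewrite big_split /= IH1 -add1n; congr addn.
  rewrite (bigD1 (Ordinal aP)) // aE eqxx big1 // => i /negbTE ni.
  by rewrite aE ni.
under eq_bigr do rewrite mulnDr.
rewrite big_split /= IH2; congr addn.
rewrite (bigD1 (Ordinal aP)) // aE eqxx big1 => [|i /negbTE ni].
  by rewrite /= muln1 addn0; case: a a0 {aN aP aE}.
by rewrite aE ni muln0.
Qed.

(* Substituting y_i = c^i x yields c^(n+rs) S~(n,k,r) x^k. *)
Lemma mod_bell_subst (m : nat) (c x : {mpoly rat[m]}) :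
  mod_bell \mPo [tuple c ^+ i.+1 * x | i < n + r * s] =
  mod_stirling2 *: (c ^+ (n + r * s) * x ^+ k).
Proof.
rewrite /mod_stirling2 /mod_bell; set N := (n + r * s)%N.
rewrite raddf_sum /= [in RHS]raddf_sum /= scaler_suml.
apply: eq_bigr => t /andP[/and3P[_ n0 /eqP sN] _].
rewrite comp_mpolyZ mevalZ -[in RHS]scalerA; congr (_ *: _).
have ltN : all (fun a => a <= N)%N (map val t).
  by apply/allP => _ /mapP[i _ ->]; rewrite -ltnS ltn_ord.
have [cnt1 cntN] := sum_count n0 ltN.
rewrite size_map size_tuple in cnt1; rewrite sN in cntN.
have -> : (bell_monomial N (map val t)).@[fun=> 1] = 1.
  rewrite rmorph_prod /= big1 // => i _.
  by rewrite rmorphXn /= mevalXU expr1n.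
rewrite scale1r /bell_monomial rmorph_prod /=.
transitivity (\prod_(i < N) (c ^+ (i.+1 * count_mem i.+1 (map val t))
                             * x ^+ count_mem i.+1 (map val t))).
  apply: eq_bigr => i _.
  by rewrite rmorphXn /= comp_mpolyXU -tnth_nth tnth_mktuple exprMn -exprM.
by rewrite big_split /= !prodrXr cnt1 cntN.
Qed.

End ModifiedBell.

(* Main.v *)
Require Import Defs.
From mathcomp Require Import all_boot all_order all_algebra.
Set Implicit Arguments.
Unset Strict Implicit.
Import GRing.Theory.

(** The point is that S~(n, k, r) = 'C(k, r) S(n, k), whatever s is; the three
    identities then follow from the binomial theorem.

    Replacing partitions of n + r s into k parts by ordered compositions turns
    the factor 1 / prod_i m_i! into 1 / k!, and e_r becomes a sum over the
    r-subsets U of the k positions.  For a fixed U, (a)_s / a! = 1 / (a - s)!,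
    so subtracting s from the parts indexed by U leaves the sum of
    n! / prod_i b_i! over the compositions b of n into k positive parts.  That
    sum counts the surjections from n points onto k points, which number
    k! S(n, k). *)

(** * Counting tuples with prescribed multiplicities *)

Lemma sum_cons_tuple (V : nmodType) (T : finType) n (P : pred (n.+1.-tuple T))
    (F : n.+1.-tuple T -> V) :
  (\sum_(t | P t) F t = \sum_x \sum_(t | P (cons_tuple x t)) F (cons_tuple x t))%R.
Proof.
rewrite pair_big_dep /=.
rewrite (reindex (fun p : T * n.-tuple T => cons_tuple p.1 p.2)) //=.
exists (fun t : n.+1.-tuple T => (thead t, [tuple of behead t])) => [[x t] _|t _] /=.
  by congr pair; exact: val_inj.
by case/tupleP: t => x t; exact: val_inj.
Qed.

(** The multinomial coefficient in division-free form. A tuple starting with x leaves a tail in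
    which the multiplicity of x is one lower; this yields m x * n! for each x, and the m x add up to
    n + 1. *)
Lemma card_tuple_count (T : finType) n (m : T -> nat) :
  \sum_v m v = n ->
  #|[set t : n.-tuple T | [forall v, count_mem v t == m v]]|
    * \prod_v (m v)`! = n`!.
Proof.
elim: n m => [|n IHn] m sum_m.
  have m0 v : m v = 0.
    by apply/eqP; rewrite -leqn0 -sum_m (bigD1 v) //= leq_addr.
  rewrite big1 ?muln1 => [|v _]; last by rewrite m0.
  rewrite (_ : [set _ | _] = setT) ?cardsT ?card_tuple //.
  by apply/setP => t; rewrite !inE (tuple0 t); apply/forallP => v; rewrite m0.
rewrite cardsE -sum1_card.
have := @sum_cons_tuple _ T n (fun t => [forall v, count_mem v t == m v]) (fun=> 1).
move=> /= ->; rewrite big_distrl /= -[RHS]/(n.+1 * n`!) -sum_m big_distrl /=.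
apply: eq_bigr => x _; case mx: (m x) => [|c].
  rewrite big_pred0 ?mul0n // => t; apply/negbTE/negP => /forallP/(_ x).
  by rewrite /= eqxx mx.
pose m' v := if v == x then c else m v.
have m_split v : m v = (x == v) + m' v.
  by rewrite /m' eq_sym; case: eqP => // ->.
have sum_m' : \sum_v m' v = n.
  apply/eqP; rewrite -eqSS -sum_m (eq_bigr _ (fun v _ => m_split v)) big_split /=.
  by rewrite -[X in X.+1]add0n -addSn eqn_add2r (bigD1 x) //= eqxx big1 // => v;
    rewrite eq_sym => /negbTE->.
have -> : \prod_v (m v)`! = c.+1 * \prod_v (m' v)`!.
  rewrite (bigD1 x) //= [in RHS](bigD1 x) //= mx /m' eqxx mulnA.
  by congr (_ * _); apply: eq_bigr => v /negbTE->.
rewrite mulnCA -(IHn _ sum_m') cardsE -sum1_card; congr (_ * (_ * _)).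
apply: eq_bigl => t; apply: eq_forallb => v /=.
by rewrite m_split eqn_add2l.
Qed.

(** * Surjections and set partitions *)

Section Stirling.
Variables n k : nat.
Implicit Type t : n.-tuple 'I_k.

Definition tuple_surj t := [forall v, v \in t].

Definition fibers t : {ffun 'I_k -> {set 'I_n}} := [ffun v => [set i | tnth t i == v]].

Definition fiber_partition t : {set {set 'I_n}} := [set fibers t v | v : 'I_k].

Lemma fibers_inj : injective fibers.
Proof.
move=> t u tu; apply: eq_from_tnth => i; apply/esym/eqP.
by move/ffunP/(_ (tnth t i))/setP/(_ i): tu; rewrite !ffunE !inE eqxx.
Qed.

Lemma fibers_surj_inj t : tuple_surj t -> injective (fibers t).
Proof.
move=> /forallP surj_t v w; rewrite !ffunE => /setP vw.
by have /tnthP[i vi] := surj_t v; have := vw i; rewrite !inE -vi eqxx => /esym/eqP.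
Qed.

Lemma card_fiber_partition t : tuple_surj t -> #|fiber_partition t| = k.
Proof. by move=> /fibers_surj_inj inj; rewrite card_imset // card_ord. Qed.

Lemma fiber_partitionP t : tuple_surj t -> partition (fiber_partition t) [set: 'I_n].
Proof.
move=> /forallP surj_t; apply/and3P; split.
- rewrite eqEsubset subsetT; apply/subsetP => i _; apply/bigcupP.
  by exists (fibers t (tnth t i)); rewrite ?imset_f // ffunE inE.
- apply/trivIsetP => _ _ /imsetP[v _ ->] /imsetP[w _ ->] nvw.
  rewrite -setI_eq0; apply/eqP/setP => i; rewrite !ffunE !inE.
  apply/negbTE/negP => /andP[/eqP vi /eqP wi].
  by rewrite -vi -wi eqxx in nvw.
- apply/negP => /imsetP[v _ /setP v0].
  by have /tnthP[i vi] := surj_t v; have := v0 i; rewrite ffunE !inE vi eqxx.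
Qed.

(** A surjection with fibre partition P amounts to a labelling of the blocks of P by ['I_k]:
    [fibers] maps these surjections bijectively to the injections from ['I_k] into P. *)
Lemma card_fiber_partition_eq (P : {set {set 'I_n}}) :
  partition P [set: 'I_n] -> #|P| = k ->
  #|[set t | tuple_surj t && (fiber_partition t == P)]| = k`!.
Proof.
move=> partP cardP.
have <- : #|[set g : {ffun 'I_k -> _} in ffun_on (mem P) | injectiveb g]| = k`!.
  by rewrite card_inj_ffuns_on card_ord [#|_|]cardP ffactnn.
rewrite -(card_imset _ fibers_inj); apply: eq_card => g.
rewrite !inE; apply/imsetP/andP => [[t + ->]|[/ffun_onP gP /injectiveP g_inj]].
  rewrite inE => /andP[surj_t /eqP <-]; split.
    by apply/ffun_onP => v; rewrite imset_f.
  exact/injectiveP/fibers_surj_inj.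
(* An injection between sets of the same size k is onto. *)
have imgP : [set g v | v : 'I_k] = P.
  apply/eqP; rewrite -(geq_leqif (subset_leqif_cards _)).
    by rewrite card_imset // card_ord cardP.
  by apply/subsetP => _ /imsetP[v _ ->]; exact: gP.
case/and3P: partP => /eqP covP trivP P0.
(* The tuple with fibres g sends i to the label of a block containing i; disjointness of the blocks
   makes this label unique. *)
have pick_g i : {v | i \in g v}.
  apply: sigW; have: i \in cover P by rewrite covP.
  by case/bigcupP => B; rewrite -imgP => /imsetP[v _ ->]; exists v.
have fibE : g = fibers [tuple sval (pick_g i) | i < n].
  apply/ffunP => v; rewrite ffunE; apply/setP => i; rewrite inE tnth_mktuple.
  case: (pick_g i) => w /= iw; apply/idP/eqP => [iv|<- //].
  apply: g_inj; rewrite -(def_pblock trivP _ iw) ?gP //.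
  by rewrite -(def_pblock trivP _ iv) ?gP.
exists [tuple sval (pick_g i) | i < n] => //.
rewrite inE /fiber_partition -fibE imgP eqxx andbT; apply/forallP => v.
have /set0Pn[i]: g v != set0 by apply: contraNneq P0 => <-; exact: gP.
by rewrite {1}fibE ffunE inE => /eqP<-; exact: mem_tnth.
Qed.

Lemma card_tuple_surj : #|[set t | tuple_surj t]| = k`! * stirling2 n k.
Proof.
rewrite cardsE -sum1_card (partition_big fiber_partition
  (fun P => partition P [set: 'I_n] && (#|P| == k))) /=; last first.
  by move=> t st; rewrite fiber_partitionP ?card_fiber_partition /=.
rewrite mulnC /stirling2 cardsE -sum1_card big_distrl /=.
apply: eq_bigr => P /andP[partP /eqP cardP]; rewrite mul1n.
by rewrite -(card_fiber_partition_eq partP cardP) cardsE sum1_card.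
Qed.

End Stirling.

(** * From sorted tuples to all tuples *)

Lemma sum_count_mem (T : finType) (s : seq T) : \sum_v count_mem v s = size s.
Proof.
elim: s => [|x s IHs] /=; first by rewrite big1.
rewrite big_split IHs (bigD1 x) //= eqxx big1 // => v.
by rewrite eq_sym => /negbTE->.
Qed.

Lemma prod_expn_count_mem (T : finType) (s : seq T) (F : T -> nat) :
  \prod_v F v ^ count_mem v s = \prod_(x <- s) F x.
Proof.
elim: s => [|x s IHs] /=; first by rewrite big_nil big1.
rewrite big_cons -IHs.
under eq_bigr do rewrite expnD.
rewrite big_split (bigD1 x) //= eqxx expn1 big1 ?muln1 // => v.
by rewrite eq_sym => /negbTE->.
Qed.

Local Open Scope ring_scope.

Lemma fact_rat_neq0 m : m`!%:R != 0 :> rat.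
Proof. by rewrite Num.Theory.pnatr_eq0 -lt0n fact_gt0. Qed.

Section SortedTuples.
Variables (T : finType) (leT : rel T) (k : nat).
Hypotheses (leT_total : total leT) (leT_tr : transitive leT).
Hypothesis leT_asym : antisymmetric leT.

(* A multiset with multiplicities m_v has k! / prod_v m_v! orderings. *)
Lemma sum_sorted_tuple (Q : pred (seq T)) (F : seq T -> rat) :
  (forall u v : seq T, perm_eq u v -> Q u = Q v) ->
  (forall u v : seq T, perm_eq u v -> F u = F v) ->
  \sum_(t : k.-tuple T | sorted leT t && Q t)
     F t / (\prod_v (count_mem v t)`!)%:R
  = (k`!)%:R^-1 * \sum_(t : k.-tuple T | Q t) F t.
Proof.
move=> permQ permF.
(* Tuples are grouped by their sorted form, so each group is a full permutation class, on which F is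
   constant. *)
rewrite [X in _ * X](partition_big (fun u : k.-tuple T => [tuple of sort leT u])
  (fun t : k.-tuple T => sorted leT t && Q t)) /=; last first.
  by move=> u Qu; rewrite sort_sorted //= (permQ _ u) // perm_sort.
rewrite big_distrr /=; apply: eq_bigr => t /andP[sorted_t Qt].
have permE (u : k.-tuple T) : Q u && ([tuple of sort leT u] == t) = perm_eq u t.
  apply/andP/idP => [[_ /eqP <-]|ut]; first by rewrite perm_sym perm_sort.
  rewrite (permQ _ _ ut); split=> //; apply/eqP/val_inj => /=.
  apply: (sorted_eq leT_tr leT_asym) => //; first exact: sort_sorted.
  by rewrite perm_sort.
rewrite (eq_bigl _ _ permE) (eq_bigr (fun=> F t)) => [|u /permF //].
rewrite sumr_const.
have -> : #|[pred u : k.-tuple T | perm_eq u t]| =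
    #|[set u : k.-tuple T | [forall v, count_mem v u == count_mem v t]]|.
  rewrite cardsE; apply: eq_card => u; rewrite !inE.
  apply/idP/forallP => [/permP ut v|cnt]; first exact/eqP.
  by apply/allP => v _; apply: cnt.
have := card_tuple_count (m := fun v => count_mem v t) _.
move/(_ k); rewrite sum_count_mem size_tuple => /(_ erefl) <-.
rewrite natrM invfM -[F t *+ _]mulr_natl mulrACA mulVf ?mul1r 1?mulrC //.
(* The size of the class was cancelled; were it 0, then k! would be 0. *)
apply/negP => c0; have := fact_gt0 k.
have := card_tuple_count (m := fun v => count_mem v t) _.
move/(_ k); rewrite sum_count_mem size_tuple => /(_ erefl) <-.
by move: c0; rewrite Num.Theory.pnatr_eq0 => /eqP->.
Qed.

End SortedTuples.

(** * Weighted sums over compositions *)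

Definition composition (B k n : nat) (b : k.-tuple 'I_B.+1) : bool :=
  [forall i, (0 < tnth b i)%N] && (\sum_i tnth b i == n)%N.

(** Surjections are grouped by their fibre sizes b, and [card_tuple_count] gives n! / prod_i b_i! of
    them for each b. Surjectivity is positivity of all b_i, and n <= B lets every fibre size be
    stored in ['I_B.+1]. *)
Lemma sum_composition (B k n : nat) : (n <= B)%N ->
  \sum_(b : k.-tuple 'I_B.+1 | composition n b) \prod_i ((tnth b i)`!)%:R^-1
  = (k`! * stirling2 n k)%:R / (n`!)%:R :> rat.
Proof.
move=> nB; rewrite -card_tuple_surj cardsE -sum1_card.
pose p (t : n.-tuple 'I_k) : k.-tuple 'I_B.+1 := [tuple inord (count_mem i t) | i < k].
have pE (t : n.-tuple 'I_k) i : tnth (p t) i = count_mem i t :> nat.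
  rewrite tnth_mktuple inordK // ltnS (leq_trans _ nB) //.
  by rewrite -{2}(size_tuple t) count_size.
rewrite (partition_big p (composition n)) /=; last first.
  move=> t /forallP surj_t; apply/andP; split.
    by apply/forallP => i; rewrite pE -has_count has_pred1; apply: surj_t.
  by under eq_bigr do rewrite pE; rewrite sum_count_mem size_tuple.
rewrite natr_sum mulr_suml; apply: eq_bigr => b /andP[/forallP b_gt0 /eqP sum_b].
have tE (t : n.-tuple 'I_k) : (tuple_surj t && (p t == b)) =
    [forall v, count_mem v t == tnth b v].
  apply/andP/forallP => [[_ /eqP <-] v|cnt]; first by rewrite pE.
  split; first by apply/forallP => v; rewrite -has_pred1 has_count (eqP (cnt v)).
  by apply/eqP/eq_from_tnth => i; apply/val_inj; rewrite /= pE (eqP (cnt i)).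
rewrite (eq_bigl _ _ tE) sum1_card -(card_tuple_count sum_b) cardsE.
rewrite prodfV -natr_prod natrM invfM mulrA divff ?mul1r //.
apply/negP => c0; have := fact_gt0 n; rewrite -(card_tuple_count sum_b) cardsE.
by move: c0; rewrite Num.Theory.pnatr_eq0 => /eqP->.
Qed.

(** The test excludes a = s, where [a ^_ s] is s! and not 0; the lowered part a - s is then always
    positive. *)
Definition falling_gt (s a : nat) : rat := if (s < a)%N then (a ^_ s)%:R else 0.

(* Since (a)_s / a! = 1 / (a - s)!, lowering by s the parts indexed by U turns
   the summand into that of [sum_composition]. *)
Lemma sum_composition_shift (s n r k : nat) (U : {set 'I_k}) : #|U| = r ->
  \sum_(u : k.-tuple 'I_(n + r * s).+1 | composition (n + r * s) u)
     (\prod_i ((tnth u i)`!)%:R^-1) * \prod_(i in U) falling_gt s (tnth u i)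
  = (k`! * stirling2 n k)%:R / (n`!)%:R.
Proof.
move=> cardU; set N := (n + r * s)%N.
rewrite -(@sum_composition N) ?leq_addr //.
pose d i : nat := if i \in U then s else 0%N.
have sum_d : (\sum_i d i = r * s)%N.
  by rewrite /d -big_mkcond /= sum_nat_const cardU.
pose large (u : k.-tuple 'I_N.+1) := [forall i, (d i < tnth u i)%N].
(* If u is not [large], some u_i <= d i; positivity of u_i forces i into U, and the factor at i
   vanishes. *)
rewrite (bigID large) /= [X in _ + X]big1 ?addr0; last first.
  move=> u /andP[/andP[/forallP u_gt0 _]]; rewrite negb_forall => /existsP[i].
  rewrite -leqNgt /d; case: ifPn => [iU ui|_]; last by rewrite leqNgt u_gt0.
  by rewrite [X in _ * X](bigD1 i) //= /falling_gt ltnNge ui mul0r mulr0.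
pose up (b : k.-tuple 'I_N.+1) : k.-tuple 'I_N.+1 :=
  [tuple inord (tnth b i + d i) | i < k].
pose down (u : k.-tuple 'I_N.+1) : k.-tuple 'I_N.+1 :=
  [tuple inord (tnth u i - d i) | i < k].
have downE (u : k.-tuple 'I_N.+1) i : tnth (down u) i = (tnth u i - d i)%N :> nat.
  by rewrite tnth_mktuple inordK // (leq_ltn_trans (leq_subr _ _)).
have upE (b : k.-tuple 'I_N.+1) i :
    (tnth b i + d i <= N)%N -> tnth (up b) i = (tnth b i + d i)%N :> nat.
  by move=> bd; rewrite tnth_mktuple inordK.
have le_sum (f : 'I_k -> nat) i : (f i <= \sum_j f j)%N.
  by rewrite (bigD1 i) //= leq_addr.
rewrite (reindex_onto up down) => [|u /andP[_ /forallP lu]] /=; last first.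
  apply/eq_from_tnth => i; apply/val_inj => /=.
  have E : (tnth (down u) i + d i = tnth u i)%N by rewrite downE subnK // ltnW.
  by rewrite upE E // -ltnS.
(* [inord] does not overflow here: b_i <= n and d i <= r * s. *)
have upP (b : k.-tuple 'I_N.+1) :
    composition n b -> forall i, tnth (up b) i = (tnth b i + d i)%N :> nat.
  case/andP=> _ /eqP sum_b i; apply: upE.
  apply: leq_add; last by rewrite -sum_d le_sum.
  by have := le_sum (fun j => tnth b j) i; rewrite sum_b.
have idxE (b : k.-tuple 'I_N.+1) :
    (composition N (up b) && large (up b) && (down (up b) == b)) =
    composition n b.
  apply/idP/idP => [|cb].
    move=> /andP[/andP[/andP[/forallP up_gt0 /eqP sum_up] /forallP lu] /eqP bE].
    (* With no bound on b known yet, overflow in [up] is excluded by [down (up b) = b] together with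
       [large]. *)
    have bdE i : (tnth (up b) i = tnth b i + d i :> nat)%N.
      by rewrite -{2}bE downE subnK // ltnW.
    apply/andP; split.
      by apply/forallP => i; have := lu i; rewrite bdE -[X in (X < _)%N]add0n ltn_add2r.
    move: sum_up; under eq_bigr do rewrite bdE.
    by rewrite big_split /= sum_d => /addIn ->.
  have upb := upP _ cb; case/andP: cb => /forallP b_gt0 /eqP sum_b.
  apply/andP; split; last first.
    by apply/eqP/eq_from_tnth => i; apply/val_inj; rewrite /= downE upb addnK.
  apply/andP; split; last first.
    by apply/forallP => i; rewrite upb -[X in (X < _)%N]add0n ltn_add2r.
  apply/andP; split; first by apply/forallP => i; rewrite upb ltn_addr.
  by under eq_bigr do rewrite upb; rewrite big_split /= sum_d sum_b.
rewrite (eq_bigl _ _ idxE); apply: eq_bigr => b cb.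
rewrite [X in _ * X]big_mkcond /= -big_split /=; apply: eq_bigr => i _.
rewrite (upP _ cb) /d; case: ifP => iU; last by rewrite addn0 mulr1.
have b_gt0 : (0 < tnth b i)%N by case/andP: cb => /forallP.
rewrite /falling_gt -[X in (X < _)%N]add0n ltn_add2r b_gt0.
have := ffact_fact (leq_addl (tnth b i) s); rewrite addnK => <-.
rewrite natrM invfM mulrC mulrA divff ?mul1r //.
by rewrite Num.Theory.pnatr_eq0 -lt0n ffact_gt0 leq_addl.
Qed.

(** * Elementary symmetric functions as polynomial coefficients *)

Lemma coef_prod_1DZX (I : finType) (c : I -> rat) (r : nat) :
  (\prod_i (1 + c i *: 'X))`_r = \sum_(U : {set I} | #|U| == r) \prod_(i in U) c i.
Proof.
under eq_bigr do rewrite addrC.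
rewrite bigA_distr coef_sum [RHS]big_mkcond /=.
apply: eq_bigr => U _.
rewrite -big_mkcond /= scaler_prod prodr_const coefZ coefXn eq_sym.
by case: eqP; rewrite ?mulr1 ?mulr0.
Qed.

Lemma elem_symE (r : nat) (l : seq nat) :
  elem_sym r l = (\prod_(a <- l) (1 + a%:R *: 'X))`_r.
Proof.
rewrite (big_nth 0%N) big_mkord coef_prod_1DZX /elem_sym /mesym raddf_sum /=.
apply: eq_bigr => U _; rewrite rmorph_prod /=.
by apply: eq_bigr => i _; rewrite mevalXU.
Qed.

(** A part at most s gives the factor 1, so the product may run over all parts; this form is visibly
    invariant under permutation. *)
Lemma elem_sym_falling (s r : nat) (la : seq nat) :
  elem_sym r (falling_parts s (parts_gt s la)) =
  (\prod_(a <- la) (1 + falling_gt s a *: 'X))`_r.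
Proof.
rewrite elem_symE big_map big_filter big_mkcond /=; congr ((_ : {poly rat})`_r).
apply: eq_bigr => a _; rewrite /falling_gt.
by case: ifP => _ //; rewrite scale0r addr0.
Qed.

Lemma elem_sym_eq0 (r : nat) (l : seq nat) : (size l < r)%N -> elem_sym r l = 0.
Proof.
move=> lr; rewrite elem_symE (big_nth 0%N) big_mkord coef_prod_1DZX big_pred0 // => U.
apply/negbTE; rewrite neq_ltn (leq_ltn_trans _ lr) //.
by rewrite (leq_trans (max_card _)) ?card_ord.
Qed.

(** * Evaluation of the modified Stirling numbers *)

Lemma bell_denominator (N : nat) (t : seq 'I_N.+1) : 0%N \notin map val t ->
  (\prod_(i < N) (i.+1`! ^ count_mem i.+1 (map val t)
                  * (count_mem i.+1 (map val t))`!) =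
   (\prod_(a <- t) a`!) * \prod_v (count_mem v t)`!)%N.
Proof.
move=> t0; rewrite -(prod_expn_count_mem t) -big_split big_ord_recl /=.
have cntE (v : 'I_N.+1) : count_mem v t = count_mem (val v) (map val t).
  by rewrite count_map; apply: eq_count => w /=; rewrite val_eqE.
rewrite cntE (count_memPn t0) /= muln1 mul1n.
by apply: eq_bigr => i _; rewrite cntE.
Qed.

Theorem mod_stirling2E (s n k r : nat) :
  mod_stirling2 s n k r = ('C(k, r) * stirling2 n k)%:R.
Proof.
rewrite /mod_stirling2 /mod_bell; set N := (n + r * s)%N.
pose F (t : seq 'I_N.+1) : rat :=
  (\prod_(a <- t) (a`!)%:R^-1) * (\prod_(a <- t) (1 + falling_gt s a *: 'X))`_r.
pose Q (t : seq 'I_N.+1) := (0%N \notin map val t) && (sumn (map val t) == N).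
pose ge_ord (a b : 'I_N.+1) := (b <= a)%N.
transitivity (\sum_(t : k.-tuple 'I_N.+1 | sorted ge_ord t && Q t)
    (n`!)%:R * (F t / (\prod_v (count_mem v t)`!)%:R)).
  (* The condition on the number of parts above s becomes a case distinction: with fewer than r such
     parts, e_r is 0 and both sides vanish. *)
  rewrite raddf_sum /= big_mkcondr /=.
  rewrite (eq_bigl (fun t : k.-tuple _ => sorted ge_ord t && Q t)).
    apply: eq_bigr => t /and3P[_ t0 _]; rewrite mevalZ.
    have -> : (bell_monomial N (map val t)).@[fun=> 1] = 1.
      rewrite rmorph_prod /= big1 // => i _.
      by rewrite rmorphXn /= mevalXU expr1n.
    rewrite mulr1 /bell_coef bell_denominator // elem_sym_falling big_map.
    rewrite natrM natr_prod invfM /F prodfV.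
    case: leqP => [_|small]; first by rewrite -!mulrA; congr (_ * _); rewrite mulrCA.
    have := elem_sym_eq0 (l := falling_parts s (parts_gt s (map val t))).
    move/(_ r); rewrite size_map => /(_ small); rewrite elem_sym_falling big_map => ->.
    by rewrite mulr0 mul0r mulr0.
  by move=> t; rewrite /is_intpart sorted_map.
rewrite -mulr_sumr sum_sorted_tuple; first last.
- move=> u v uv; rewrite /F; congr (_ * (_ : {poly rat})`_r); exact: perm_big.
- move=> u v uv; have uv' := perm_map val uv.
  by rewrite /Q (perm_mem uv') (perm_sumn uv').
- by move=> a b /anti_leq ab; apply/val_inj.
- by move=> b a c ba ac; apply: leq_trans ac ba.
- by move=> a b; apply: leq_total.
have QE (t : k.-tuple 'I_N.+1) : Q t = composition N t.
  rewrite /Q /composition sumnE big_map big_tuple; congr (_ && _).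
  apply/idP/forallP => [t0 i|t_gt0].
    rewrite lt0n; apply: contraNneq t0 => <-.
    by apply/map_f/mem_tnth.
  by apply/negP => /mapP[_ /tnthP[i ->] ti0]; have := t_gt0 i; rewrite -ti0.
rewrite (eq_bigl _ _ QE).
under eq_bigr => t _ do rewrite /F !big_tuple coef_prod_1DZX mulr_sumr.
(* With the r-subset U outermost, the inner sum over compositions no longer depends on U; the number
   of such U supplies the binomial coefficient. *)
rewrite exchange_big /=.
rewrite (eq_bigr (fun=> (k`! * stirling2 n k)%:R / (n`!)%:R)); last first.
  by move=> U /eqP cardU; apply: sum_composition_shift.
rewrite sumr_const -[_ *+ #|_|]mulr_natl.
have -> : #|[pred U : {set 'I_k} | #|U| == r]| = 'C(k, r).
  by rewrite -cardsE card_draws card_ord.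
rewrite !natrM -(mulrA k`!%:R) (mulrCA 'C(k, r)%:R) mulKf ?fact_rat_neq0 //.
by rewrite mulrCA [X in _ * X]mulrCA divff ?fact_rat_neq0 // mulr1.
Qed.

(** * The three identities *)

Theorem mainTheorem6 (n s : nat) :
  (let c : {mpoly rat[2]} := 'X_ord0 in
   let x : {mpoly rat[2]} := 'X_ord_max in
   \sum_(0 <= r < n.+1) \sum_(r <= k < n.+1)
      mod_stirling2 s n k r *: (c ^+ (n + r * s) * x ^+ k)
   = c ^+ n * (touchard {mpoly rat[2]} n).[(c ^+ s + 1) * x])
  /\ \sum_(0 <= k < n.+1) (\sum_(0 <= r < k.+1) mod_stirling2 s n k r) *: 'X^k
     = touchard rat n \Po (2%:R *: 'X)
  /\ (forall k : nat, (k <= n)%N ->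
        \sum_(0 <= r < k.+1) mod_stirling2 s n k r
        = 2%:R ^+ k * (stirling2 n k)%:R).
Proof.
have row_sum k : \sum_(0 <= r < k.+1) mod_stirling2 s n k r
                 = 2%:R ^+ k * (stirling2 n k)%:R.
  under eq_bigr do rewrite mod_stirling2E natrM.
  rewrite -mulr_suml -natr_sum big_mkord -natrX -[2%N]/(1 + 1)%N expnDn.
  by congr ((_)%:R * _); apply: eq_bigr => r _; rewrite !exp1n !muln1.
split; [move=> c x | split=> [|k _]; last exact: row_sum].
  have termE r k : mod_stirling2 s n k r *: (c ^+ (n + r * s) * x ^+ k) =
      c ^+ n * ((stirling2 n k)%:R * (x ^+ k * ((c ^+ s) ^+ r *+ 'C(k, r)))).
    rewrite mod_stirling2E scaler_nat exprD [(r * s)%N]mulnC exprM mulrnA.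
    rewrite -[LHS]mulr_natl !mulrnAr -mulrA mulrCA; congr (_ * (_ * _) *+ _).
    exact: mulrC.
  (* The terms with k < r vanish with ['C(k, r)]; adding them makes the range rectangular, so the
     sums can be exchanged. *)
  transitivity (\sum_(0 <= r < n.+1) \sum_(0 <= k < n.+1)
      mod_stirling2 s n k r *: (c ^+ (n + r * s) * x ^+ k)).
    rewrite !big_mkord; apply: eq_bigr => r _.
    rewrite [RHS](big_cat_nat (n := r)) //=; last exact: ltnW.
    rewrite -[LHS]add0r; congr (_ + _).
    rewrite big_nat_cond big1 // => k /andP[/andP[_ kr] _].
    by rewrite termE bin_small // mulr0n !mulr0.
  rewrite exchange_big /= /touchard horner_sum big_mkord mulr_sumr.
  apply: eq_bigr => k _; rewrite hornerZ hornerXn.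
  under eq_bigr do rewrite termE.
  rewrite -!mulr_sumr exprMn [c ^+ s + 1]addrC exprDn [_ * x ^+ k]mulrC.
  congr (_ * (_ * (_ * _))).
  (* Dropping the zero terms with r > k leaves the binomial expansion of (1 + c^s)^k. *)
  rewrite (big_cat_nat (n := k.+1)) //= [X in _ + X]big_nat_cond.
  rewrite [X in _ + X]big1 ?addr0 => [|r /andP[/andP[kr _] _]].
    by rewrite big_mkord; apply: eq_bigr => r _; rewrite expr1n mul1r.
  by rewrite bin_small.
rewrite /touchard rmorph_sum /= big_mkord; apply: eq_bigr => k _.
rewrite row_sum comp_polyZ comp_Xn_poly exprZn scalerA.
by rewrite mulrC.
Qed.
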